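(* Let $n$ be a positive integer and let $1 \leq p \leq \infty$. For any rational subset $R \subseteq \mathbb{Z}^n$ the asymptotic density $\rho_p(R)$ exists. Moreover, if $R$ is given by a semi-simple decomposition $R = \bigcup_{i=1}^{k} (a_i + B_i^* )$ (a finite disjoint union of simple sets, with $a_i \in \mathbb{Z}^n$ and $B_i \subset \mathbb{Z}^n$ finite), then $\rho_p(R) = \sum_{i=1}^{k} \rho_p(B_i^* )$.
   Context: Rational sets: the class of rational subsets of the commutative monoid $(\mathbb{Z}^n,+)$ is the least class $\mathfrak{R}$ of subsets of $\mathbb{Z}^n$ such that (1) $\emptyset \in \mathfrak{R}$ and $\{m\} \in \mathfrak{R}$ for every $m \in \mathbb{Z}^n$; (2) if $X, Y \in \mathfrak{R}$ then $X \cup Y \in \mathfrak{R}$; (3) if $X, Y \in \mathfrak{R}$ then $X + Y = \{x+y \mid x \in X, y \in Y\} \in \mathfrak{R}$; (4) if $X \in \mathfrak{R}$ then $X^* \in \mathfrak{R}$, where $X^*$ is the submonoid of $\mathbb{Z}^n$ generated by $X$, i.e. the set of all finite sums (including the empty sum $0$) of elements of $X$. Simple and semi-simple sets: a set of the form $a + B^*$ with $a \in \mathbb{Z}^n$ and $B \subset \mathbb{Z}^n$ finite is called linear; it is called simple if $B^*$ is a free commutative monoid with basis $B$, i.e. if, writing $B = \{b_1,\dots,b_r\}$ with $r$ elements, every element of $B^*$ is $n_1 b_1 + \dots + n_r b_r$ for unique $n_1,\dots,n_r \in \mathbb{N} = \{0,1,2,\dots\}$. A finite union of pairwise disjoint simple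 sets is called semi-simple, and such an expression is a semi-simple decomposition. Asymptotic density: for $1 \leq p \leq \infty$ and $r \in \mathbb{N}$ let $B_{p,r} = \{v \in \mathbb{R}^n \mid \|v\|_p \leq r\}$ and $B_{p,r}(\mathbb{Z}) = B_{p,r} \cap \mathbb{Z}^n$, where $\|\cdot\|_p$ is the standard $\ell^p$-norm on $\mathbb{R}^n$. For $M \subseteq \mathbb{Z}^n$ put $\rho_{p,r}(M) = \frac{|M \cap B_{p,r}|}{|B_{p,r}(\mathbb{Z})|}$ and $\rho_p(M) = \lim_{r \to \infty} \rho_{p,r}(M)$ (over integers $r$) when the limit exists. An equality involving values of $\rho_p$ includes the assertion that the limits in question exist. *)

(* Defs.v *)
From HB Require Import structures.
From mathcomp Require Import all_boot all_order all_algebra finmap.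
From mathcomp Require Import zify.
From mathcomp Require Import all_classical all_reals all_analysis.

Set Implicit Arguments.
Unset Strict Implicit.
Unset Printing Implicit Defensive.

Import Order.TTheory GRing.Theory Num.Theory.
Import numFieldNormedType.Exports.

Local Open Scope classical_set_scope.
Local Open Scope ring_scope.

(** Z^n is ['rV[int]_n]. *)

Definition sumset (n : nat) (X Y : set 'rV[int]_n) : set 'rV[int]_n :=
  [set x + y | x in X & y in Y].

(** X^*: finite sums of elements of X, repetitions allowed; the empty sequence
    gives 0. *)
Definition star (n : nat) (X : set 'rV[int]_n) : set 'rV[int]_n :=
  [set x | exists2 s : seq 'rV[int]_n,
     {in s, forall y, X y} & x = \sum_(y <- s) y].

Inductive rational_subset (n : nat) : set 'rV[int]_n -> Prop :=
| rational0 : rational_subset set0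
| rational1 (m : 'rV[int]_n) : rational_subset [set m]
| rationalU (X Y : set 'rV[int]_n) :
    rational_subset X -> rational_subset Y -> rational_subset (X `|` Y)
| rationalD (X Y : set 'rV[int]_n) :
    rational_subset X -> rational_subset Y -> rational_subset (sumset X Y)
| rational_star (X : set 'rV[int]_n) :
    rational_subset X -> rational_subset (star X).

Definition linear_set (n : nat) (a : 'rV[int]_n) (B : {fset 'rV[int]_n}) :
    set 'rV[int]_n :=
  [set a + x | x in star [set` B]].

Definition free_basis (n : nat) (B : {fset 'rV[int]_n}) : Prop :=
  forall x : 'rV[int]_n, star [set` B] x ->
    exists! c : {ffun B -> nat}, x = \sum_(b : B) val b *+ c b.

Definition semi_simple_decomposition (n : nat) (X : set 'rV[int]_n) (k : nat)
    (a : 'I_k -> 'rV[int]_n) (B : 'I_k -> {fset 'rV[int]_n}) : Prop :=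
  [/\ forall i : 'I_k, free_basis (B i),
      forall i j : 'I_k, i != j ->
        linear_set (a i) (B i) `&` linear_set (a j) (B j) = set0
    & X = \bigcup_(i : 'I_k) linear_set (a i) (B i)].

(** Only meaningful for 1 <= p; the value at -oo is a dummy. *)
Definition lpnorm (R : realType) (p : \bar R) (n : nat) (v : 'rV[R]_n) : R :=
  match p with
  | q%:E => (\sum_(i < n) `|v 0 i| `^ q) `^ q^-1
  | +oo%E => \big[Num.max/0]_(i < n) `|v 0 i|
  | -oo%E => 0
  end.

Definition lpball (R : realType) (p : \bar R) (n r : nat) : set 'rV[R]_n :=
  [set v | lpnorm p v <= r%:R].

Definition lpball_int (R : realType) (p : \bar R) (n r : nat) :
    set 'rV[int]_n :=
  [set v | lpball p r (map_mx intr v)].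

Lemma finite_lpball_int (R : realType) (p : \bar R) (n r : nat) :
  (1 <= p)%E -> finite_set (@lpball_int R p n r).
Proof.
move=> p1.
have bnd (v : 'rV[int]_n) i : lpball_int p r v -> (`|v ord0 i| <= r)%N.
  rewrite /lpball_int /lpball /= => vr.
  rewrite -(ler_nat R) natr_absz intr_norm; apply: le_trans vr.
  case: p p1 => [q| |] //=; last first.
    by move=> _; apply: (le_trans _ (le_bigmax _ _ i)); rewrite !mxE.
  rewrite lee_fin => q1; have q0 : 0 < q by exact: lt_le_trans q1.
  have -> : `|(v 0 i)%:~R| = (`|(v 0 i)%:~R| `^ q) `^ q^-1 :> R.
    by rewrite -powRrM divff ?gt_eqF// powRr1.
  apply: ge0_ler_powR; rewrite ?invr_ge0 ?(ltW q0) ?nnegrE ?powR_ge0//.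
    by apply: sumr_ge0 => j _; exact: powR_ge0.
  rewrite (bigD1 i)//= !mxE lerDl.
  by apply: sumr_ge0 => j _; exact: powR_ge0.
pose f (u : 'rV['I_(r + r).+1]_n) : 'rV[int]_n :=
  map_mx (fun z : 'I_(r + r).+1 => z%:Z - r%:Z) u.
apply: (@sub_finite_set _ _ (f @` setT)); last first.
  by apply: finite_image; exact: finite_finset.
move=> v vr; exists (map_mx (fun z : int => inord (absz (z + r%:Z))) v) => //.
apply/rowP => i; rewrite !mxE.
have := bnd v i vr.
set z := v 0 i => zr.
have z0 : 0 <= z + r%:Z by lia.
by rewrite inordK; lia.
Qed.

(** [fset_set A] is the finite set A (and fset0 if A is infinite); it is applied
    only to subsets of the finite set [lpball_int p r]. *)
Definition rho_r (R : realType) (p : \bar R) (n : nat) (M : set 'rV[int]_n)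
    (r : nat) : R :=
  #|` fset_set (M `&` @lpball_int R p n r)|%:R /
  #|` fset_set (@lpball_int R p n r)|%:R.

Definition has_density (R : realType) (p : \bar R) (n : nat)
    (M : set 'rV[int]_n) : Prop :=
  cvgn (rho_r p M).

(** Junk value unless [has_density p M]. *)
Definition rho (R : realType) (p : \bar R) (n : nat) (M : set 'rV[int]_n) : R :=
  limn (rho_r p M).

(* Main.v *)
Require Import Defs.
From mathcomp Require Import all_boot all_order all_algebra finmap.
From mathcomp Require Import zify ring lra.
From mathcomp Require Import all_classical all_reals all_analysis.

Set Implicit Arguments.
Unset Strict Implicit.
Unset Printing Implicit Defensive.

Import Order.TTheory GRing.Theory Num.Theory.
Import numFieldNormedType.Exports.

Local Open Scope classical_set_scope.
Local Open Scope ring_scope.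

(** A rational set is a finite union of linear sets a + B^*, and a relation of
    linear dependence between the elements of B breaks a + B^* into finitely many
    linear sets with fewer generators; so only linearly independent B are needed.
    For those, membership of x in a + B^* says that x - a lies on certain
    hyperplanes, that its coordinates with respect to B are nonnegative, and that
    they are integral. Hence every rational set is cut out by finitely many
    rational half-spaces and by congruences modulo a single m
    ([semilinear_presburger]).

    Such a set M looks the same at all scales. Replacing an integer point u by k^n
    points v with v = u modulo m and |v - ku| <= km gives, for every k, a partition
    of Z^n into groups of k^n points indexed by Z^n ([stretch]). Unless u is within
    a bounded distance of one of the bounding hyperplanes or of the sphere of
    radius r, u lies in M and in the ball of radius r if and only if v lies in M
    and in the ball of radius kr. Only O(r^(n-1)) exceptional u are near the ball of
    radius r, so the number f(r) of points of M in this ball satisfies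
    |f(kr) - k^n f(r)| <= c k^n r^(n-1) ([presburger_scaling]). Consequently
    f(kr)/(kr)^n and f(r)/r^n differ by at most c/r, and comparison of r and s with
    rs shows that f(r)/r^n is a Cauchy sequence ([cvgn_of_scaling]). The same holds
    for the whole of Z^n, where the limit is positive; the quotient of the limits is
    the density.

    The exceptional sets are thin for one reason, isolated in [cnt_thin]: some
    direction exists such that every line in this direction meets the set in
    a bounded segment. For a slab around a hyperplane it is a coordinate direction;
    for the neighbourhood of an lp-sphere it is, in each orthant, the diagonal
    direction, along which the norm increases because it is monotone in the absolute
    values of the coordinates.

    For the second assertion, translation by a moves only the points near the
    sphere in or out of a ball, so a + B^* and B^* have the same density, and
    counting points in a ball is additive over disjoint unions. *)

(** * Counting finite sets *)

Definition cnt (T : choiceType) (A : set T) : nat := #|` fset_set A|.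

Lemma cnt_inj (T U : choiceType) (A : set T) (B : set U) (f : T -> U) :
  finite_set B -> (forall x, A x -> B (f x)) ->
  {in A &, injective f} -> (cnt A <= cnt B)%N.
Proof.
move=> finB fAB injf.
have finA : finite_set A.
  rewrite -(eq_finite_set (inj_card_eq injf)).
  by apply: sub_finite_set finB => _ [x Ax <-]; exact: fAB.
rewrite /cnt.
have -> : #|` fset_set A| = #|` [fset f x | x in fset_set A]%fset|.
  by rewrite card_in_imfset// => x y; rewrite !in_fset_set// => ? ?; exact: injf.
apply: fsubset_leq_card; apply/fsubsetP => _ /imfsetP[x /= xA ->].
by move: xA; rewrite !in_fset_set// !inE; exact: fAB.
Qed.

Lemma cntT (T : finType) : cnt [set: T] = #|T|.
Proof.
have -> : #|T| = #|` [fset x | x in T]%fset| by rewrite card_imfset//= cardT.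
congr (#|` _|); apply/fsetP => x; rewrite in_fset_set; last exact: finite_finset.
rewrite in_setT.
by apply/esym/imfsetP; exists x.
Qed.

Lemma cnt_setX (T U : choiceType) (A : set T) (B : set U) :
  finite_set A -> finite_set B -> cnt (A `*` B) = (cnt A * cnt B)%N.
Proof.
move=> fA fB; rewrite /cnt fset_setX// /fsetM.
rewrite (perm_size (enum_imfset2 _ _)); last by move=> [? ?] [? ?] _ _ /= [-> ->].
by rewrite size_allpairs.
Qed.

Lemma cntS (T : choiceType) (A B : set T) :
  finite_set B -> A `<=` B -> (cnt A <= cnt B)%N.
Proof. by move=> fB AB; apply: (@cnt_inj _ _ _ _ id). Qed.

Lemma cntU_le (T : choiceType) (A B : set T) :
  finite_set A -> finite_set B -> (cnt (A `|` B) <= cnt A + cnt B)%N.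
Proof. by move=> fA fB; rewrite /cnt fset_setU// -cardfsUI leq_addr. Qed.

(** * Balls and thin sets of integer points *)

(** What the counting needs to know of the integer points [B r] of the balls of
    radius [r] of a norm. [gauge_solid] is the monotonicity in the absolute values
    of the coordinates; [gauge_absorb] makes the balls of positive volume.
    Working with these five properties treats all exponents p at once. *)
Record gauge (n : nat) (B : nat -> set 'rV[int]_n) : Prop := Gauge {
  gauge_solid : forall r (u v : 'rV[int]_n),
    (forall i, `|u 0%R i| <= `|v 0%R i|)%N -> B r v -> B r u;
  gauge_incr : forall r s (v : 'rV[int]_n), (r <= s)%N -> B r v -> B s v;
  gauge_scale : forall k r (v : 'rV[int]_n), (0 < k)%N ->
    B (k * r)%N (v *+ k) <-> B r v;
  gauge_coord : forall r (v : 'rV[int]_n) i, B r v -> (`|v 0%R i| <= r)%N;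
  gauge_absorb : exists r, B r (const_mx 1)
}.

Definition box (n r : nat) : set 'rV[int]_n :=
  [set v | forall i, (`|v 0%R i| <= r)%N].

Lemma finite_box n r : finite_set (@box n r).
Proof.
pose f (u : 'rV['I_(r + r).+1]_n) : 'rV[int]_n :=
  map_mx (fun z : 'I_(r + r).+1 => z%:Z - r%:Z) u.
apply: (@sub_finite_set _ _ (f @` setT)); last first.
  by apply: finite_image; exact: finite_finset.
move=> v vr; exists (map_mx (fun z : int => inord (absz (z + r%:Z))) v) => //.
apply/rowP => i; rewrite !mxE; have := vr i.
by set z := v 0 i => zr; rewrite inordK; lia.
Qed.

Lemma finite_gauge n (B : nat -> set 'rV[int]_n) r :
  gauge B -> finite_set (B r).
Proof.
move=> gB; apply: sub_finite_set (finite_box n r) => v Bv i.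
exact: (gauge_coord gB i Bv).
Qed.

(** The coordinate [i0] of [v - (v_i0 * e_i0) e] vanishes, hence a line in the
    direction [e] is determined by the [n.-1] other coordinates of this vector,
    each bounded by [2 * r]. Two points of [E] on the same line differ by [t e] with
    [t < c], so on each line the residue of [v_i0] modulo [c] separates them. *)
Lemma cnt_thin n (i0 : 'I_n) (e : 'rV[int]_n) (r c : nat) (E : set 'rV[int]_n) :
  (forall i, `|e 0%R i| <= 1)%N -> `|e 0%R i0|%N = 1%N -> E `<=` box r ->
  (forall v t, E v -> E (v + e *+ t) -> (t < c)%N) ->
  (cnt E <= c * (4 * r).+1 ^ n.-1)%N.
Proof.
move=> e1 ei0 Er Ec.
case: c Ec => [|c] Ec.
  suff -> : E = set0 by rewrite /cnt fset_set0.
  by rewrite -subset0 => v Ev; have /= := Ec v 0%N Ev; rewrite mulr0n addr0 => /(_ Ev).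
(* [s v] is the position of [v] on its line and [q v] the name of that line. *)
pose s (v : 'rV[int]_n) : int := v 0 i0 * e 0 i0.
pose q (v : 'rV[int]_n) i : int := v 0 i - s v * e 0 i.
pose f (v : 'rV[int]_n) : 'I_c.+1 * {ffun 'I_n.-1 -> 'I_(4 * r).+1} :=
  (inord `|(v 0%R i0 %% c.+1%:Z)%Z|,
   [ffun j => inord `|q v (lift i0 j) + (2 * r)%N%:Z| ]).
suff finj : {in E &, injective f}.
  apply: (@leq_trans (cnt [set: 'I_c.+1 * {ffun 'I_n.-1 -> 'I_(4 * r).+1}])).
    by apply: (@cnt_inj _ _ _ _ f) => //; exact: finite_finset.
  by rewrite cntT card_prod card_ffun !card_ord.
have qr v i : E v -> (`|q v i| <= 2 * r)%N.
  move=> Ev; rewrite /q /s; have := Er v Ev i; have := Er v Ev i0.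
  have := e1 i; move: ei0; move: (v 0 i) (v 0 i0) (e 0 i) (e 0 i0) => a b x y.
  move=> y1 x1 br ar.
  have [->|->] : y = 1 \/ y = -1 by lia.
    by have [->|[->|->]] : x = 1 \/ x = -1 \/ x = 0; lia.
  by have [->|[->|->]] : x = 1 \/ x = -1 \/ x = 0; lia.
have key v w : E v -> E w -> s w <= s v -> f v = f w -> v = w.
  move=> Ev Ew svw [] m1 m2.
  have qE i : q v i = q w i.
    case: (unliftP i0 i) => [j ->|->].
      have /ffunP/(_ j) := m2; rewrite !ffunE.
      have := qr v (lift i0 j) Ev; have := qr w (lift i0 j) Ew.
      by move=> qw qv /(congr1 val); rewrite /= !inordK; lia.
    rewrite /q /s; have [->|->] : e 0 i0 = 1 \/ e 0 i0 = -1 by lia.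
      by lia.
    by lia.
  pose t := `|s v - s w|%N.
  have tE : t%:Z = s v - s w by rewrite /t; lia.
  have vE : v = w + e *+ t.
    apply/rowP => i; rewrite !mxE mulmxnE -mulr_natl natz tE.
    have := qE i; rewrite /q mulrBl.
    by move: (v 0 i) (w 0 i) (s v * e 0 i) (s w * e 0 i) => a b x y; lia.
  have tc : (t < c.+1)%N by apply: (Ec w t) => //; rewrite -vE.
  suff t0 : t = 0%N by rewrite vE t0 mulr0n addr0.
  have : (v 0%R i0 %% c.+1%:Z)%Z = (w 0%R i0 %% c.+1%:Z)%Z.
    by move/(congr1 val): m1; rewrite /= !inordK; lia.
  move/eqP; rewrite eqz_mod_dvd dvdzE.
  have -> : `|(v 0 i0 - w 0 i0)%R|%N = t.
    move: tE; rewrite /s; move: (v 0 i0) (w 0 i0) ei0 => a b y1.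
    by have [->|->] : e 0 i0 = 1 \/ e 0 i0 = -1; lia.
  by case: (posnP t) => // t0 /(dvdn_leq t0); rewrite /= leqNgt tc.
move=> v w; rewrite !inE => Ev Ew.
by have [?|/ltW ?] := leP (s w) (s v) => ?; [|symmetry]; apply: key.
Qed.

(** Up to constants, [n.-1] is the largest growth exponent that is negligible against
    the number of points of a ball. *)
Definition thin (n : nat) (E : nat -> set 'rV[int]_n) : Prop :=
  exists c, forall r, (0 < r)%N ->
    finite_set (E r) /\ (cnt (E r) <= c * r ^ n.-1)%N.

Lemma thinS n (E F : nat -> set 'rV[int]_n) :
  (forall r, E r `<=` F r) -> thin F -> thin E.
Proof.
move=> EF [c cP]; exists c => r r0; have [fF cF] := cP r r0.
by split; [exact: sub_finite_set fF|exact: leq_trans (cntS fF (EF r)) cF].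
Qed.

Lemma thin0 n : @thin n (fun=> set0).
Proof. by exists 0%N => r _; rewrite /cnt fset_set0. Qed.

Lemma thinU n (E F : nat -> set 'rV[int]_n) :
  thin E -> thin F -> thin (fun r => E r `|` F r).
Proof.
move=> [c cP] [d dP]; exists (c + d)%N => r r0.
have [fE cE] := cP r r0; have [fF cF] := dP r r0.
split; first by rewrite finite_setU.
by rewrite mulnDl (leq_trans (cntU_le fE fF))// leq_add.
Qed.

Lemma thin_bigcup n (I : eqType) (s : seq I) (E : I -> nat -> set 'rV[int]_n) :
  (forall i, thin (E i)) ->
  thin (fun r => [set v | exists2 i, i \in s & E i r v]).
Proof.
move=> tE; elim: s => [|i s IHs].
  by apply: thinS (thin0 n) => r v [].
apply: thinS (thinU (tE i) IHs) => r v [j].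
by rewrite inE => /orP[/eqP->|js] Ev; [left|right; exists j].
Qed.

(** The form of [cnt_thin] used below: for [r > 0] one has
    [4 * (r + b) + 1 <= (4 * b + 5) * r]. *)
Lemma thin_lines n (i0 : 'I_n) (e : 'rV[int]_n) (b c : nat)
    (E : nat -> set 'rV[int]_n) :
  (forall i, `|e 0%R i| <= 1)%N -> `|e 0%R i0|%N = 1%N ->
  (forall r, E r `<=` box (r + b)) ->
  (forall r v t, E r v -> E r (v + e *+ t) -> (t < c)%N) -> thin E.
Proof.
move=> e1 ei0 Eb Ec; exists (c * (4 * b + 5) ^ n.-1)%N => r r0.
split; first exact: sub_finite_set (Eb r) (finite_box _ _).
apply: leq_trans (cnt_thin e1 ei0 (Eb r) (Ec r)) _.
rewrite -mulnA -expnMn leq_mul//.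
by case: n.-1 => [|m]; rewrite ?expn0// leq_exp2r//; nia.
Qed.

Definition infl n (a : nat) (v : 'rV[int]_n) : 'rV[int]_n :=
  \row_i (`|v 0%R i| + a)%N%:Z.

Definition defl n (a : nat) (v : 'rV[int]_n) : 'rV[int]_n :=
  \row_i (`|v 0%R i| - a)%N%:Z.

(** The points within about [a] of the sphere of radius [r], with the norms of
    [|v| - a] and [|v| + a], taken coordinatewise, in place of a distance. Since the
    norm is monotone, anything that differs from [v] by at most [a] in each
    coordinate has norm between these two. *)
Definition shell n (B : nat -> set 'rV[int]_n) (a r : nat) : set 'rV[int]_n :=
  [set v | B r (defl a v) /\ ~ B r (infl a v)].

(** In the orthant with signs [s], moving by [t] along the diagonal direction of the
    orthant adds [t] to the absolute value of every coordinate. If [v] and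
    [v + t e] are both in the shell and [t >= 2 * a], then [|v| + a] is dominated
    by [|v + t e| - a], which is in the ball while [|v| + a] is not. *)
Lemma thin_shell n (B : nat -> set 'rV[int]_n) a :
  (0 < n)%N -> gauge B -> thin (shell B a).
Proof.
case: n B => // n B _ gB.
pose e (s : {ffun 'I_n.+1 -> bool}) : 'rV[int]_n.+1 := \row_i (-1) ^+ s i.
pose E s r := shell B a r `&` [set v | forall i, 0 <= v 0 i * e s 0 i].
have e1 s i : `|e s 0%R i|%N = 1%N by rewrite mxE; case: (s i).
apply: (@thinS _ _ (fun r => [set v | exists2 s, s \in enum {ffun 'I_n.+1 -> bool} & E s r v])).
  move=> r v vE; exists [ffun i => v 0 i < 0]; first by rewrite mem_enum.
  by split=> // i; rewrite !mxE ffunE; case: ltP => /=; lia.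
apply: thin_bigcup => s.
apply: (@thin_lines _ ord0 (e s) a (2 * a)) => [i||r v|r v t].
- by rewrite e1.
- by rewrite e1.
- by move=> [[Bv _] _] i; have := gauge_coord gB i Bv; rewrite mxE; lia.
move=> [[_ nBv] v0] [[Bw _] w0]; rewrite ltnNge; apply/negP => ta.
apply: nBv; apply: (gauge_solid gB) Bw => i; rewrite !mxE mulmxnE.
have := v0 i; have := w0 i; rewrite !mxE mulmxnE !mxE.
by case: (s i); rewrite /=; lia.
Qed.

(** Off the shell, the ball of radius [r] decides the membership of the whole cube
    of half-side [a] around [u], and dilating this cube by [k] the ball of
    radius [k * r] does. For [k = 1] this is the effect of a bounded translation. *)
Lemma gauge_near n (B : nat -> set 'rV[int]_n) (a k r : nat) (u v : 'rV[int]_n) :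
  gauge B -> (0 < k)%N -> (forall i, `|(v 0 i - u 0 i *+ k)%R| <= k * a)%N ->
  ~ shell B a r u -> (B (k * r)%N v <-> B r u).
Proof.
move=> gB k0 uv /not_andP[nBu|/contrapT Bu].
  split=> [Bv|Bu]; exfalso; apply: nBu.
    apply/(gauge_scale gB r (defl a u) k0).
    apply: (gauge_solid gB) Bv => i; have := uv i; rewrite mulmxnE mxE.
    by move: (u 0 i) (v 0 i) => x y; nia.
  by apply: (gauge_solid gB) Bu => i; rewrite mxE; lia.
split=> _.
  by apply: (gauge_solid gB) Bu => i; rewrite mxE; lia.
move/(gauge_scale gB r _ k0): Bu; apply: (gauge_solid gB) => i.
have := uv i; rewrite mulmxnE mxE.
by move: (u 0 i) (v 0 i) => x y; nia.
Qed.

Definition lform n (l : 'cV[rat]_n) (v : 'rV[int]_n) : rat :=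
  \sum_(i < n) (v 0 i)%:~R * l i 0.

Definition l1norm n (l : 'cV[rat]_n) : rat := \sum_(i < n) `|l i 0|.

Lemma lformD n (l : 'cV[rat]_n) u v : lform l (u + v) = lform l u + lform l v.
Proof. by rewrite -big_split; apply: eq_bigr => i _; rewrite mxE intrD mulrDl. Qed.

Lemma lformMn n (l : 'cV[rat]_n) u k : lform l (u *+ k) = lform l u *+ k.
Proof.
by rewrite /lform -sumrMnl; apply: eq_bigr => i _; rewrite mulmxnE rmorphMn mulrnAl.
Qed.

Lemma lform_le n (l : 'cV[rat]_n) (v : 'rV[int]_n) (a : nat) :
  box a v -> `|lform l v| <= l1norm l *+ a.
Proof.
move=> va; rewrite /l1norm -sumrMnl (le_trans (ler_norm_sum _ _ _))//.
apply: ler_sum => i _; rewrite normrM -[leRHS]mulr_natl ler_wpM2r//.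
by rewrite -intr_norm -natr_absz ler_nat; exact: va.
Qed.

(** Some coefficient of [l] is nonzero, and along that coordinate the value of [l]
    leaves the interval from [- c] to [c] after boundedly many steps. *)
Lemma thin_slab n (l : 'cV[rat]_n) (c : rat) : l != 0 ->
  thin (fun r => [set v | `|lform l v| <= c] `&` box r).
Proof.
move=> l0; have [i0 li0] : exists i0, l i0 0 != 0.
  apply/existsP; apply: contraR l0; rewrite negb_exists => /forallP l0.
  by apply/eqP/colP => i; rewrite mxE; apply/eqP; have := l0 i; rewrite negbK.
pose C := Num.bound (2 * c / `|l i0 0|).
apply: (@thin_lines _ i0 (delta_mx 0 i0) 0 C.+1) => [i||r v|r v t].
- by rewrite mxE; case: (_ && _).
- by rewrite mxE !eqxx.
- by rewrite addn0 => -[].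
move=> [/= vc _] []; rewrite /= lformD lformMn => wc _.
have dE : lform l (delta_mx 0 i0) = l i0 0.
  rewrite /lform (bigD1 i0)//= mxE !eqxx mul1r big1 ?addr0// => i ni.
  by rewrite mxE (negbTE ni) andbF mul0r.
rewrite dE in wc; rewrite ltnS -(ler_nat rat).
apply: le_trans (ltW (archi_boundP _)); last first.
  by apply: divr_ge0 => //; have := normr_ge0 (lform l v); lra.
rewrite ler_pdivlMr ?normr_gt0//.
rewrite -[X in X * _](@ger0_norm rat t%:R)// -normrM [t%:R * _]mulr_natl.
have := ler_normB (lform l v + l i0 0 *+ t) (lform l v).
by rewrite addrAC subrr add0r; lra.
Qed.

(** * Scale invariance of sets defined by half-spaces and congruences *)

Definition above n (h : 'cV[rat]_n * rat) (v : 'rV[int]_n) : bool :=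
  h.2 <= lform h.1 v.

Definition congruent n (m : nat) (u v : 'rV[int]_n) : Prop :=
  forall i, (u 0%R i %% m = v 0%R i %% m)%Z.

(** Boolean combinations of rational half-spaces and congruences, in a form that
    does not mention the combination: membership depends only on the residue modulo
    [m] and on the side of each hyperplane. This makes the Boolean closure
    properties immediate; by Presburger's quantifier elimination these are the sets
    definable in the ordered additive group of the integers. *)
Definition presburger n (M : set 'rV[int]_n) : Prop :=
  exists m (hs : seq ('cV[rat]_n * rat)), (0 < m)%N /\
    forall u v, congruent m u v -> {in hs, forall h, above h u = above h v} ->
      (M u <-> M v).

(** [lform h.1 v] differs from [k] times [lform h.1 u] by at most [k] times the
    variation of the form over a cube of half-side [m]. If [lform h.1 u] exceeds
    [|h.2|] in absolute value by more than this variation, [lform h.1 v] has the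
    same sign and still exceeds [|h.2|] in absolute value. *)
Lemma above_near n (h : 'cV[rat]_n * rat) (m k : nat) (u v : 'rV[int]_n) :
  (0 < k)%N -> box (k * m) (v - u *+ k) ->
  `|h.2| + l1norm h.1 *+ m < `|lform h.1 u| -> above h v = above h u.
Proof.
move=> k0 /(lform_le h.1) vu hu.
have k1 : 1 <= k%:R :> rat by rewrite ler1n.
have vE : lform h.1 v = lform h.1 (v - u *+ k) + lform h.1 u *+ k.
  by rewrite -lformMn -lformD subrK.
rewrite /above vE; move: vu; set d := lform _ (v - _) => dk.
rewrite mulnC mulrnA -[X in _ <= X]mulr_natl in dk; rewrite -[_ *+ k]mulr_natl.
move: hu dk; set c := h.2; set x := lform _ _; set y := _ *+ m => cx dk.
have cc := ler_norm c; have cc' := ler_norm (- c); rewrite normrN in cc'.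
have dd := ler_norm d; have dd' := ler_norm (- d); rewrite normrN in dd'.
have c0 := normr_ge0 c.
have [x0|x0] := leP 0 x.
  rewrite (ger0_norm x0) in cx.
  have : k%:R * (`|c| + y) <= k%:R * x by rewrite ler_wpM2l ?ler0n//; lra.
  have : `|c| <= k%:R * `|c| by rewrite ler_peMl.
  have y0 : 0 <= y by rewrite mulrn_wge0//; apply: sumr_ge0.
  by rewrite mulrDr => ? ?; apply/idP/idP => _; lra.
rewrite (ltr0_norm x0) in cx.
have : k%:R * x < - (k%:R * (`|c| + y)).
  by rewrite -mulrN ltr_pM2l ?ltr0n//; lra.
have : `|c| <= k%:R * `|c| by rewrite ler_peMl.
have y0 : 0 <= y by rewrite mulrn_wge0//; apply: sumr_ge0.
by rewrite mulrDr => ? ?; apply/idP/idP => ?; lra.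
Qed.

Lemma modz_range (m : nat) (x : int) : (0 < m)%N -> 0 <= (x %% m)%Z < m%:Z.
Proof. by move=> m0; rewrite modz_ge0 ?ltz_pmod//; lia. Qed.

Lemma modz_divz (m : nat) (x : int) : (0 < m)%N -> ((x %% m)%Z %/ m)%Z = 0.
Proof. by move=> m0; rewrite divz_small//; have := modz_range x m0; lia. Qed.

(** Coordinatewise, write [x = (Q * k + q) * m + rho] with [0 <= q < k] and
    [0 <= rho < m]. Erasing the digit [q] from [x] gives [u = Q * m + rho], congruent
    to [x] modulo [m] and close to [x / k]; [stretch] inserts the digit and
    [shrink] erases and returns it. *)
Definition stretch n (m k : nat) (uq : 'rV[int]_n * {ffun 'I_n -> 'I_k}) :
    'rV[int]_n :=
  \row_i (((uq.1 0%R i %/ m)%Z * k%:Z + (uq.2 i)%:Z) * m%:Z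
          + (uq.1 0%R i %% m)%Z).

Definition shrink n (m k : nat) (v : 'rV[int]_n) :
    'rV[int]_n * {ffun 'I_n -> 'I_k.+1} :=
  (\row_i (((v 0%R i %/ m)%Z %/ k.+1%:Z)%Z * m%:Z + (v 0%R i %% m)%Z),
   [ffun i => inord `|((v 0%R i %/ m)%Z %% k.+1%:Z)%Z|]).

Lemma stretch_divz n (m k : nat) (uq : 'rV[int]_n * {ffun 'I_n -> 'I_k}) i : (0 < m)%N ->
  (stretch m uq 0%R i %/ m)%Z = (uq.1 0%R i %/ m)%Z * k%:Z + (uq.2 i)%:Z.
Proof.
move=> m0; rewrite mxE divzMDl; last by lia.
by rewrite modz_divz// addr0.
Qed.

Lemma congruent_stretch n (m k : nat) (uq : 'rV[int]_n * {ffun 'I_n -> 'I_k}) :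
  congruent m uq.1 (stretch m uq).
Proof. by move=> i; rewrite mxE modzMDl modz_mod. Qed.

Lemma shrinkK n (m k : nat) : (0 < m)%N ->
  cancel (@shrink n m k) (@stretch n m k.+1).
Proof.
move=> m0 v; apply/rowP => i; rewrite !mxE /= ffunE ?mxE.
rewrite divzMDl ?modzMDl ?modz_mod; last by lia.
rewrite modz_divz// addr0.
have := @modz_range k.+1 (v 0%R i %/ m)%Z (ltn0Sn k) => qk.
rewrite inordK; last by lia.
have -> : `|((v 0%R i %/ m)%Z %% k.+1%:Z)%Z|%N%:Z = ((v 0%R i %/ m)%Z %% k.+1%:Z)%Z by lia.
by rewrite -!divz_eq.
Qed.

Lemma stretchK n (m k : nat) : (0 < m)%N ->
  cancel (@stretch n m k.+1) (@shrink n m k).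
Proof.
move=> m0 uq; rewrite [RHS]surjective_pairing /shrink; congr pair.
  apply/rowP => i; rewrite mxE stretch_divz// divzMDl//.
  rewrite [((uq.2 i)%:Z %/ _)%Z]divz_small ?addr0; last by have := ltn_ord (uq.2 i); lia.
  by rewrite -congruent_stretch -divz_eq.
apply/ffunP => i; apply/val_inj; rewrite ffunE stretch_divz// modzMDl.
rewrite modz_small; last by have := ltn_ord (uq.2 i); lia.
by rewrite /= inordK.
Qed.

Lemma stretch_near n (m k : nat) (uq : 'rV[int]_n * {ffun 'I_n -> 'I_k}) : (0 < m)%N ->
  box (k * m) (stretch m uq - uq.1 *+ k).
Proof.
move=> m0 i; rewrite !mxE mulmxnE.
have : uq.1 0%R i = (uq.1 0%R i %/ m)%Z * m%:Z + (uq.1 0%R i %% m)%Z by exact: divz_eq.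
have := modz_range (uq.1 0%R i) m0.
have := ltn_ord (uq.2 i).
move: (uq.1 0%R i) (uq.1 0%R i %/ m)%Z (uq.1 0%R i %% m)%Z (nat_of_ord (uq.2 i)) => u a b q.
by nia.
Qed.

(** Except for [u] in the thin set [bad r], the [k ^ n] points
    [stretch m (u, q)] are in [M] and in the ball of radius [k * r] exactly when [u]
    is in [M] and in the ball of radius [r]. Both inequalities follow by counting
    through the bijection [stretch]. *)
Lemma presburger_scaling n (B : nat -> set 'rV[int]_n) (M : set 'rV[int]_n) :
  (0 < n)%N -> gauge B -> presburger M ->
  exists c, forall r k, (0 < r)%N -> (0 < k)%N ->
    (cnt (M `&` B (k * r)%N) <= k ^ n * (cnt (M `&` B r) + c * r ^ n.-1))%N /\
    (k ^ n * cnt (M `&` B r) <= cnt (M `&` B (k * r)%N) + k ^ n * (c * r ^ n.-1))%N.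
Proof.
move=> n0 gB [m [hs [m0 MP]]].
pose slab (h : 'cV[rat]_n * rat) r : set 'rV[int]_n :=
  [set v | h.1 != 0 /\ `|lform h.1 v| <= `|h.2| + l1norm h.1 *+ m] `&` box r.
pose bad r := shell B m r `|` [set v | exists2 h, h \in hs & slab h r v].
have [c cP] : thin bad.
  apply: thinU (thin_shell _ n0 gB) _; apply: thin_bigcup => -[l c].
  have [l0|l0] := eqVneq l 0.
    by apply: thinS (thin0 n) => r v [[/=]]; rewrite l0 eqxx.
  by apply: thinS (thin_slab (`|c| + l1norm l *+ m) l0) => r v [[]].
exists c => r k r0; case: k => // k _.
have [finbad cbad] := cP r r0.
have finM s : finite_set (M `&` B s).
  exact: sub_finite_set (@subIsetr _ _ _) (finite_gauge s gB).
have good (uq : 'rV[int]_n * {ffun 'I_n -> 'I_k.+1}) : ~ bad r uq.1 ->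
    ((M `&` B (k.+1 * r)%N) (stretch m uq) <-> (M `&` B r) uq.1).
  move=> /not_orP[nsh nsl].
  have BE : B (k.+1 * r)%N (stretch m uq) <-> B r uq.1.
    apply: (gauge_near gB _ _ nsh) => // i.
    by have := stretch_near uq m0 i; rewrite !mxE mulmxnE.
  have ME : B r uq.1 -> M (stretch m uq) <-> M uq.1.
    move=> Bu; apply: iff_sym; apply: MP; first exact: congruent_stretch.
    move=> h hhs; apply: esym.
    (* The zero form is constant, and its slab would not be thin. *)
    have [l0|l0] := eqVneq h.1 0.
      by rewrite /above l0 /lform !big1// => i _; rewrite [X in _ * X]mxE mulr0.
    apply: (@above_near _ _ m k.+1) => //; first exact: stretch_near.
    rewrite ltNge; apply/negP => hle; apply: nsl; exists h => //; split=> //.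
    by move=> i; exact: (gauge_coord gB i Bu).
  by rewrite /setI /mkset; tauto.
pose D := [set: {ffun 'I_n -> 'I_k.+1}].
have finD : finite_set D by exact: finite_finset.
have cD : cnt D = (k.+1 ^ n)%N by rewrite cntT card_ffun !card_ord.
have finU : finite_set ((M `&` B r) `|` bad r) by rewrite finite_setU.
split.
  rewrite [leqRHS]mulnC -cD.
  apply: (@leq_trans (cnt (((M `&` B r) `|` bad r) `*` D))).
    apply: (@cnt_inj _ _ _ _ (@shrink n m k)).
    - exact: finite_setX.
    - move=> v Mv; split; last by [].
      have [vbad|/good[vgood _]] := pselect (bad r (shrink m k v).1).
        by right.
      by left; apply: vgood; rewrite shrinkK.
    - by move=> v w _ _; exact: can_inj (shrinkK k m0) v w.
  rewrite cnt_setX// leq_mul//; apply: leq_trans (cntU_le _ _) _ => //.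
  by rewrite leq_add2l.
apply: (@leq_trans (k.+1 ^ n * (cnt ((M `&` B r) `\` bad r) + cnt (bad r)))%N).
  rewrite leq_mul//.
  apply: leq_trans (cntU_le _ _) => //; last exact: finite_setD.
  apply: cntS; first by rewrite finite_setU; split => //; exact: finite_setD.
  by move=> v Mv; have [?|?] := pselect (bad r v); [right|left].
rewrite mulnDr leq_add// ?leq_mul2l ?cbad ?orbT//.
rewrite [leqLHS]mulnC -cD -cnt_setX//; last exact: finite_setD.
apply: (@cnt_inj _ _ _ _ (@stretch n m k.+1)) => //.
  by move=> uq [[Mu nbad] _]; apply/good.
by move=> v w _ _; exact: can_inj (stretchK m0) v w.
Qed.

(** * Linear sets are defined by half-spaces and congruences *)

Lemma presburger0 n : presburger (set0 : set 'rV[int]_n).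
Proof. by exists 1%N, [::]. Qed.

Lemma presburgerT n : presburger [set: 'rV[int]_n].
Proof. by exists 1%N, [::]. Qed.

Lemma congruent_dvd n (d m : nat) (u v : 'rV[int]_n) :
  (d %| m)%N -> congruent m u v -> congruent d u v.
Proof.
move=> dm uv i; apply/eqP; rewrite eqz_mod_dvd.
have /eqP := uv i; rewrite eqz_mod_dvd; apply: dvdz_trans.
by rewrite dvdzE.
Qed.

Lemma presburger2 n (op : Prop -> Prop -> Prop) (M N : set 'rV[int]_n) :
  (forall P P' Q Q', (P <-> P') -> (Q <-> Q') -> (op P Q <-> op P' Q')) ->
  presburger M -> presburger N -> presburger [set v | op (M v) (N v)].
Proof.
move=> opE [m [hs [m0 MP]]] [m' [hs' [m'0 NP]]].
exists (m * m')%N, (hs ++ hs'); split; first by rewrite muln_gt0 m0.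
move=> u v uv huv; apply: opE; [apply: MP|apply: NP].
- by apply: congruent_dvd uv; rewrite dvdn_mulr.
- by move=> h hh; apply: huv; rewrite mem_cat hh.
- by apply: congruent_dvd uv; rewrite dvdn_mull.
- by move=> h hh; apply: huv; rewrite mem_cat hh orbT.
Qed.

Lemma presburgerU n (M N : set 'rV[int]_n) :
  presburger M -> presburger N -> presburger (M `|` N).
Proof. by apply: presburger2 => *; tauto. Qed.

Lemma presburgerI n (M N : set 'rV[int]_n) :
  presburger M -> presburger N -> presburger (M `&` N).
Proof. by apply: presburger2 => *; tauto. Qed.

Lemma presburger_exists n (I : eqType) (s : seq I) (M : I -> set 'rV[int]_n) :
  (forall i, presburger (M i)) ->
  presburger [set v | exists2 i, i \in s & M i v].
Proof.
move=> MP; elim: s => [|i s IHs].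
  rewrite (_ : mkset _ = set0); first exact: presburger0.
  by apply/seteqP; split => v // [].
rewrite (_ : mkset _ = M i `|` [set v | exists2 i, i \in s & M i v]).
  exact: presburgerU.
apply/seteqP; split => v [].
- by move=> j; rewrite inE => /orP[/eqP->|js] Mv; [left|right; exists j].
- by move=> Mv; exists i; rewrite ?mem_head.
- by move=> [j js Mv]; exists j; rewrite // inE js orbT.
Qed.

Lemma presburger_forall n (I : finType) (M : I -> set 'rV[int]_n) :
  (forall i, presburger (M i)) -> presburger [set v | forall i, M i v].
Proof.
move=> MP; rewrite (_ : mkset _ = [set v | {in enum I, forall i, M i v}]); last first.
  by apply/seteqP; split => v Mv i; [|apply: Mv; rewrite mem_enum].
elim: (enum I) => [|i s IHs].
  rewrite (_ : mkset _ = setT); first exact: presburgerT.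
  by apply/seteqP; split => v // _ i.
rewrite (_ : mkset _ = M i `&` [set v | {in s, forall i, M i v}]).
  exact: presburgerI.
apply/seteqP; split => v => [Mv|[Mi Mv] j].
  by split=> [|j js]; apply: Mv; rewrite inE ?eqxx// js orbT.
by rewrite inE => /orP[/eqP->//|]; exact: Mv.
Qed.

Lemma presburger_above n (h : 'cV[rat]_n * rat) :
  presburger [set v | above h v].
Proof.
exists 1%N, [:: h]; split=> // u v _ huv.
by rewrite /mkset huv// mem_head.
Qed.

Lemma lformN n (l : 'cV[rat]_n) v : lform (- l) v = - lform l v.
Proof. by rewrite /lform -sumrN; apply: eq_bigr => i _; rewrite mxE mulrN. Qed.

Lemma lformB n (l : 'cV[rat]_n) u v : lform l (u - v) = lform l u - lform l v.
Proof. by apply/eqP; rewrite eq_sym subr_eq -lformD subrK. Qed.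

Lemma presburger_hyperplane n (l : 'cV[rat]_n) (c : rat) :
  presburger [set v | lform l v = c].
Proof.
rewrite (_ : mkset _ = [set v | above (l, c) v] `&` [set v | above (- l, - c) v]).
  by apply: presburgerI; exact: presburger_above.
apply/seteqP; split => v; rewrite /above /mkset /= lformN.
  by move=> ->; split.
by rewrite lerN2 => -[? ?]; apply/eqP; rewrite eq_le; apply/andP.
Qed.

Lemma common_denom (I : finType) (f : I -> rat) :
  exists2 m : nat, (0 < m)%N & forall i, f i *+ m \is a Num.int.
Proof.
exists (\prod_i `|denq (f i)|)%N.
  by apply: prodn_gt0 => i; rewrite absz_gt0 denq_neq0.
move=> i; rewrite (bigD1 i)//= mulrnA; apply: rpredMn.
rewrite -mulr_natr natr_absz ger0_norm ?denq_ge0// -numqE.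
exact: intr_int.
Qed.

(** A common denominator [m] of the coefficients of [l] makes the class of
    [lform l v] modulo the integers a function of [v] modulo [m]. *)
Lemma presburger_integral n (l : 'cV[rat]_n) (c : rat) :
  presburger [set v | lform l v - c \is a Num.int].
Proof.
have [m m0 mP] := common_denom (fun i => l i 0).
exists m, [::]; split=> // u v uv _.
suff uvZ : lform l (u - v) \is a Num.int.
  rewrite /mkset; have -> : lform l u - c = lform l v - c + lform l (u - v).
    by rewrite lformB; ring.
  by rewrite rpredDr.
apply: rpred_sum => i _; rewrite !mxE.
have /eqP := uv i; rewrite eqz_mod_dvd => /dvdzP[q ->].
by rewrite rmorphM/= -mulrA mulr_natl rpredM ?intr_int.
Qed.

Definition linset n k (a : 'rV[int]_n) (b : 'I_k -> 'rV[int]_n) :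
    set 'rV[int]_n :=
  [set x | exists c : 'I_k -> nat, x = a + \sum_i b i *+ c i].

Definition rowsQ n k (b : 'I_k -> 'rV[int]_n) : 'M[rat]_(k, n) :=
  \matrix_i map_mx intr (b i).

Lemma lform_col n m (P : 'M[rat]_(n, m)) (v : 'rV[int]_n) i :
  lform (col i P) v = (map_mx intr v *m P) 0 i.
Proof. by rewrite mxE; apply: eq_bigr => j _; rewrite !mxE. Qed.

Lemma rowsQ_comb n k (b : 'I_k -> 'rV[int]_n) (z : 'I_k -> int) :
  map_mx intr (\sum_i b i *~ z i) = (\row_i (z i)%:~R) *m rowsQ b.
Proof.
rewrite mulmx_sum_row raddf_sum; apply: eq_bigr => i _.
by rewrite mxE rowK raddfMz -scaler_int.
Qed.

Lemma map_mx_intr_inj n : injective (map_mx intr : 'rV[int]_n -> 'rV[rat]_n).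
Proof.
move=> u v /rowP uv; apply/rowP => i; have := uv i.
by rewrite !mxE; apply: intr_inj.
Qed.

(** With [A] the matrix of the generators, [v - a] is a rational combination of the
    rows of [A] if and only if the cokernel of [A] annihilates it; as [A] has free
    rows, the coefficients are then unique and given by the pseudo-inverse [P]. It
    remains to ask that they be nonnegative integers. *)
Lemma presburger_free n k (a : 'rV[int]_n) (b : 'I_k -> 'rV[int]_n) :
  row_free (rowsQ b) -> presburger (linset a b).
Proof.
move=> freeb; set A := rowsQ b in freeb; pose P := pinvmx A.
rewrite (_ : linset a b =
  [set v | forall j, lform (col j (cokermx A)) v = lform (col j (cokermx A)) a] `&`
  ([set v | forall i, above (col i P, lform (col i P) a) v] `&`
   [set v | forall i, lform (col i P) v - lform (col i P) a \is a Num.int])).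
  apply: presburgerI.
    by apply: presburger_forall => j; exact: presburger_hyperplane.
  apply: presburgerI; apply: presburger_forall => i.
    exact: presburger_above.
  exact: presburger_integral.
apply/seteqP; split => v.
  move=> [c vE].
  have yE : map_mx intr (v - a) = (\row_i (c i)%:R) *m A :> 'rV[rat]_n.
    rewrite vE addrC addKr (_ : \sum_i _ = \sum_i b i *~ (c i)%:Z)//.
    by rewrite rowsQ_comb; congr (_ *m _); apply/rowP => i; rewrite !mxE.
  have PE i : lform (col i P) (v - a) = (c i)%:R.
    by rewrite lform_col yE mulmxKp// mxE.
  split=> [j|].
    apply/eqP; rewrite -subr_eq0 -lformB lform_col yE -mulmxA mulmx_coker mulmx0.
    by rewrite mxE.
  split=> i; last by rewrite -lformB PE.
  by rewrite /above /= -subr_ge0 -lformB PE.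
move=> [ker [pos integ]].
have yA : (map_mx intr (v - a) <= A)%MS.
  rewrite submxE; apply/eqP/rowP => j.
  by rewrite -lform_col lformB ker subrr mxE.
pose c i : int := Num.floor (lform (col i P) (v - a)).
have cE i : (c i)%:~R = lform (col i P) (v - a).
  by rewrite floorK// lformB.
have c0 i : 0 <= c i.
  by rewrite -(ler0z rat) cE lformB subr_ge0; exact: pos.
exists (fun i => `|c i|%N); apply/eqP; rewrite addrC -subr_eq; apply/eqP.
apply: map_mx_intr_inj.
rewrite (eq_bigr (fun i => b i *~ c i)); last first.
  by move=> i _; rewrite -[in RHS](gez0_abs (c0 i)).
rewrite rowsQ_comb -(mulmxKpV yA); congr (_ *m _).
by apply/rowP => i; rewrite -lform_col [RHS]mxE cE.
Qed.

Lemma integer_relation n k (b : 'I_k -> 'rV[int]_n) :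
  ~~ row_free (rowsQ b) ->
  exists2 z : 'I_k -> int, \sum_i b i *~ z i = 0 & exists i, 0 < z i.
Proof.
rewrite -kermx_eq0 => /rowV0Pn[d /sub_kermxP dA d0].
have [m m0 mP] := common_denom (fun i => d 0 i).
pose z i : int := Num.floor (d 0 i *+ m).
have zE i : (z i)%:~R = d 0 i *+ m by rewrite floorK.
have z_rel : \sum_i b i *~ z i = 0.
  apply: map_mx_intr_inj; rewrite rowsQ_comb raddf0.
  rewrite (_ : \row_i _ = m%:R *: d) -?scalemxAl ?dA ?scaler0//.
  by apply/rowP => i; rewrite !mxE zE mulr_natl.
have [i zi] : exists i, z i != 0.
  have /rV0Pn[i di] := d0; exists i.
  rewrite -(intr_eq0 rat) zE -mulr_natr mulf_neq0// pnatr_eq0.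
  by rewrite -lt0n.
have [zi0|zi0|zi0] := ltgtP (z i) 0; last by rewrite zi0 eqxx in zi.
  exists (fun i => - z i); last by exists i; rewrite oppr_gt0.
  under eq_bigr => j _ do rewrite mulrNz.
  by rewrite sumrN z_rel oppr0.
by exists z => //; exists i.
Qed.

(** Subtract [z] from [c] as often as the result stays nonnegative. An index [i]
    minimizing the quotient of [c i] by [z i], among those with [z i > 0], is where
    the next subtraction fails. *)
Lemma reduce_coef k (z : 'I_k -> int) (c : 'I_k -> nat) :
  (exists i, 0 < z i) ->
  exists2 t : nat, (forall i, 0 <= (c i)%:Z - t%:Z * z i) &
    exists2 i, 0 < z i & (c i)%:Z - t%:Z * z i < z i.
Proof.
move=> [i1 zi1].
case: (arg_minnP (P := fun i => 0 < z i) (fun i => c i %/ `|z i|)%N zi1) => i zi imin.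
set t := (c i %/ `|z i|)%N.
have tz j : 0 < z j -> t%:Z * z j = (t * `|z j|)%N%:Z.
  by move=> zj; rewrite PoszM gez0_abs// ltW.
exists t => [j|].
  have [zj|zj] := ltP 0 (z j); last first.
    by have : t%:Z * z j <= 0 by [apply: mulr_ge0_le0]; lia.
  rewrite tz//; have : (t * `|z j| <= c j)%N; last by lia.
  by apply: leq_trans (leq_trunc_div (c j) `|z j|); rewrite leq_mul ?imin.
exists i => //; rewrite tz//; have := divn_eq (c i) `|z i|; rewrite -/t.
have /(ltn_pmod (c i)) : (0 < `|z i|)%N by lia.
by move: (t * _)%N (_ %% _)%N => x y; lia.
Qed.

(** If the generators satisfy a relation [z], every element has a representation in
    which some coefficient [c i] is smaller than [z i] ([reduce_coef]). Moving the
    finitely many values of [b i *+ c i] into the base point leaves the generators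
    other than [b i]. *)
Lemma presburger_linset n k (a : 'rV[int]_n) (b : 'I_k -> 'rV[int]_n) :
  presburger (linset a b).
Proof.
elim: k a b => [|k IHk] a b.
  by apply: presburger_free; rewrite /row_free [rowsQ b]flatmx0 mxrank0.
have [|/integer_relation[z zrel zpos]] := boolP (row_free (rowsQ b)).
  exact: presburger_free.
rewrite (_ : linset a b = [set x | exists2 i, i \in [seq i <- enum 'I_k.+1 | 0 < z i] &
  exists2 j, j \in iota 0 `|z i|%N &
    linset (a + b i *+ j) (fun l => b (lift i l)) x]).
  by apply: presburger_exists => i; apply: presburger_exists => j; exact: IHk.
apply/seteqP; split => x.
  move=> [c ->]; have [t t0 [i zi ti]] := reduce_coef c zpos.
  exists i; first by rewrite mem_filter zi mem_enum.
  exists `|((c i)%:Z - t%:Z * z i)%R|%N.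
    by rewrite mem_iota; have := t0 i; lia.
  exists (fun l => `|((c (lift i l))%:Z - t%:Z * z (lift i l))%R|%N).
  rewrite -addrA; congr (a + _).
  transitivity (\sum_l b l *+ `|((c l)%:Z - t%:Z * z l)%R|%N); last first.
    by rewrite (bigD1_ord i).
  transitivity (\sum_i (b i *+ c i - b i *~ z i *+ t)).
    by rewrite sumrB sumrMnl zrel mul0rn subr0.
  apply: eq_bigr => l _; rewrite [RHS]pmulrn gez0_abs//.
  by rewrite mulrzBr [t%:Z * _]mulrC mulrzA.
move=> [i _ [j _ [c ->]]].
exists (fun l => if unlift i l is Some l' then c l' else j).
rewrite (bigD1_ord i)//= unlift_none addrA; congr (_ + _).
by apply: eq_bigr => l _; rewrite liftK.
Qed.

(** * Rational sets are semilinear *)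

Lemma star0 n (X : set 'rV[int]_n) : star X 0.
Proof. by exists [::] => //; rewrite big_nil. Qed.

Lemma starD n (X : set 'rV[int]_n) x y : star X x -> star X y -> star X (x + y).
Proof.
move=> [s sX ->] [t tX ->]; exists (s ++ t); last by rewrite big_cat.
by move=> z; rewrite mem_cat => /orP[/sX|/tX].
Qed.

Lemma star_incl n (X : set 'rV[int]_n) : X `<=` star X.
Proof.
move=> x Xx; exists [:: x]; last by rewrite big_seq1.
by move=> y; rewrite inE => /eqP->.
Qed.

Lemma starMn n (X : set 'rV[int]_n) x k : star X x -> star X (x *+ k).
Proof.
move=> Xx; elim: k => [|k IHk]; first by rewrite mulr0n; exact: star0.
by rewrite mulrS; exact: starD.
Qed.

Lemma star_min n (X P : set 'rV[int]_n) :
  P 0 -> (forall x y, X x -> P y -> P (x + y)) -> star X `<=` P.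
Proof.
move=> P0 PD _ [s sX ->]; elim: s sX => [|x s IHs] sX; first by rewrite big_nil.
rewrite big_cons; apply: PD; first by apply: sX; exact: mem_head.
by apply: IHs => y ys; apply: sX; rewrite inE ys orbT.
Qed.

Lemma starS n (X Y : set 'rV[int]_n) : X `<=` Y -> star X `<=` star Y.
Proof.
move=> XY; apply: star_min; first exact: star0.
by move=> x y /XY Yx; apply: starD; exact: star_incl.
Qed.

Lemma star_range n k (b : 'I_k -> 'rV[int]_n) :
  star (range b) = [set x | exists c : 'I_k -> nat, x = \sum_i b i *+ c i].
Proof.
apply/seteqP; split.
  apply: star_min; first by exists (fun=> 0%N); rewrite big1.
  move=> _ _ [i _ <-] [c ->]; exists (fun j => (j == i) + c j)%N.
  under [RHS]eq_bigr do rewrite mulrnDr.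
  rewrite big_split/=; congr (_ + _).
  by rewrite (bigD1 i)//= eqxx big1 ?addr0// => j /negbTE->.
move=> _ [c ->]; elim/big_ind: _; [exact: star0|exact: starD|move=> i _].
by apply/starMn/star_incl; exists i.
Qed.

Lemma starU n (X Y : set 'rV[int]_n) :
  star (X `|` Y) = sumset (star X) (star Y).
Proof.
apply/seteqP; split.
  apply: star_min; first by exists 0; [exact: star0|exists 0; [exact: star0|rewrite addr0]].
  move=> z _ [Xz|Yz] [x Xx [y Yy <-]].
    exists (z + x); first by apply: starD => //; exact: star_incl.
    by exists y => //; rewrite addrA.
  exists x => //; exists (z + y); first by apply: starD => //; exact: star_incl.
  by rewrite addrCA.
by move=> _ [x Xx [y Yy <-]]; apply: starD; [move: Xx|move: Yy]; apply: starS => z;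
  [left|right].
Qed.

Definition shifted n (ab : 'rV[int]_n * seq 'rV[int]_n) : set 'rV[int]_n :=
  sumset [set ab.1] (star [set` ab.2]).

Lemma shifted_nil n (a : 'rV[int]_n) : shifted (a, [::]) = [set a].
Proof.
apply/seteqP; split => [_ [_ -> [y y0 <-]]|_ ->] /=; last first.
  by exists a => //; exists 0; [exact: star0|rewrite addr0].
suff -> : y = 0 by rewrite addr0.
by move: y y0; apply: star_min.
Qed.

Lemma star_cons n (a : 'rV[int]_n) (b : seq 'rV[int]_n) w :
  star [set` a :: b] w -> exists m, exists2 y, star [set` b] y & w = a *+ m + y.
Proof.
move: w; apply: star_min.
  by exists 0%N, 0; [exact: star0|rewrite mulr0n addr0].
move=> x _ xab [m [y yb ->]]; move: xab; rewrite /= inE => /orP[/eqP->|xb].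
  by exists m.+1, y => //; rewrite mulrS addrA.
exists m, (x + y); last by rewrite addrCA.
by apply: starD => //; exact: star_incl.
Qed.

(** By commutativity, a nonempty sum of elements of [a + b^*] is [a] plus some
    more copies of [a] plus an element of [b^*]. *)
Lemma star_shifted n (a : 'rV[int]_n) (b : seq 'rV[int]_n) :
  star (shifted (a, b)) = [set 0] `|` shifted (a, a :: b).
Proof.
have bab : star [set` b] `<=` star [set` a :: b].
  by apply: starS => y yb; rewrite /= inE yb orbT.
apply/seteqP; split.
  apply: star_min; first by left.
  move=> _ x [_ -> [y yb <-]] [->|[_ -> [w wab <-]]]; right; exists a => //.
    by exists y; [exact: bab|rewrite addr0].
  exists (y + (a + w)); last by rewrite addrA.
  apply: starD; first exact: bab.
  by apply: starD => //; apply: star_incl; exact: mem_head.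
move=> _ [->|[_ -> [_ /star_cons[m [y yb ->]] <-]]]; first exact: star0.
rewrite addrCA /=; apply: starD; last first.
  by apply: star_incl; exists a => //; exists y.
apply: starMn; apply: star_incl; exists a => //; exists 0; first exact: star0.
by rewrite addr0.
Qed.

Definition semilinear n (X : set 'rV[int]_n) : Prop :=
  exists s : seq ('rV[int]_n * seq 'rV[int]_n),
    X = [set x | exists2 ab, ab \in s & shifted ab x].

Lemma semilinearU n (X Y : set 'rV[int]_n) :
  semilinear X -> semilinear Y -> semilinear (X `|` Y).
Proof.
move=> [s ->] [t ->]; exists (s ++ t); apply/seteqP; split => x.
  by move=> [[ab abs abx]|[ab abs abx]]; exists ab; rewrite // mem_cat abs ?orbT.
move=> [ab]; rewrite mem_cat => /orP[?|?] ?; by [left; exists ab|right; exists ab].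
Qed.

Lemma semilinear_shifted n (ab : 'rV[int]_n * seq 'rV[int]_n) :
  semilinear (shifted ab).
Proof.
exists [:: ab]; apply/seteqP; split => [x abx|x [ab']].
  by exists ab; rewrite ?mem_head.
by rewrite inE => /eqP->.
Qed.

Lemma semilinear0 n : semilinear (set0 : set 'rV[int]_n).
Proof. by exists [::]; apply/seteqP; split => // x []. Qed.

Lemma semilinear1 n (a : 'rV[int]_n) : semilinear [set a].
Proof.
by rewrite -shifted_nil; exact: semilinear_shifted. Qed.

Lemma semilinearD n (X Y : set 'rV[int]_n) :
  semilinear X -> semilinear Y -> semilinear (sumset X Y).
Proof.
move=> [s ->] [t ->].
exists [seq (ab.1 + cd.1, ab.2 ++ cd.2) | ab <- s, cd <- t].
have catE (b d : seq 'rV[int]_n) :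
    star [set` b ++ d] = sumset (star [set` b]) (star [set` d]).
  rewrite -starU; congr star; apply/seteqP; split => x /=; rewrite mem_cat.
    by move/orP.
  by case=> ->; rewrite ?orbT.
apply/seteqP; split => x.
  move=> [_ [ab abs [_ -> [y yb <-]]] [_ [cd cdt [_ -> [z zd <-]]] <-]].
  exists (ab.1 + cd.1, ab.2 ++ cd.2); first exact: allpairs_f.
  exists (ab.1 + cd.1) => //; exists (y + z); last by rewrite addrACA.
  by rewrite catE; exists y => //; exists z.
move=> [_ /allpairsP[[ab cd] [/= abs cdt ->]]] [_ -> [w]].
rewrite catE => -[y yb [z zd <-]] <-.
exists (ab.1 + y); first by exists ab => //; exists ab.1 => //; exists y.
exists (cd.1 + z); first by exists cd => //; exists cd.1 => //; exists z.
by rewrite /= addrACA.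
Qed.

(** [starU] turns the star of a finite union into a sum of stars, and each of these
    is semilinear by [star_shifted]. *)
Lemma semilinear_star n (X : set 'rV[int]_n) : semilinear X -> semilinear (star X).
Proof.
move=> [s ->]; elim: s => [|[a b] s IHs].
  rewrite (_ : star _ = [set 0]); first exact: semilinear1.
  apply/seteqP; split; first by apply: star_min => // x y [].
  by move=> _ ->; exact: star0.
rewrite (_ : mkset _ = shifted (a, b) `|` [set x | exists2 ab, ab \in s & shifted ab x]).
  rewrite starU star_shifted; apply: semilinearD => //.
  by apply: semilinearU; [exact: semilinear1|exact: semilinear_shifted].
apply/seteqP; split => x [].
- by move=> cd; rewrite inE => /orP[/eqP->|cds] ?; [left|right; exists cd].
- by move=> abx; exists (a, b); rewrite ?mem_head.
- by move=> [cd cds ?]; exists cd; rewrite // inE cds orbT.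
Qed.

Lemma rational_semilinear n (X : set 'rV[int]_n) :
  rational_subset X -> semilinear X.
Proof.
elim=> {X} [|a|X Y _ sX _ sY|X Y _ sX _ sY|X _ sX].
- exact: semilinear0.
- exact: semilinear1.
- exact: semilinearU.
- exact: semilinearD.
- exact: semilinear_star.
Qed.

Lemma semilinear_presburger n (X : set 'rV[int]_n) :
  semilinear X -> presburger X.
Proof.
move=> [s ->]; apply: presburger_exists => -[a b].
rewrite (_ : shifted _ = linset a (fun i => nth 0 b (i : 'I_(size b)))).
  exact: presburger_linset.
have -> : shifted (a, b) = sumset [set a] (star (range (fun i : 'I_(size b) => nth 0 b i))).
  congr (sumset _ (star _)); apply/seteqP; split => x /=.
    by move=> xb; exists (Ordinal (etrans (index_mem x b) xb)) => //=; rewrite nth_index.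
  by move=> [i _ <-]; exact: mem_nth.
rewrite star_range; apply/seteqP; split => x.
  by move=> [_ -> [_ [c ->] <-]]; exists c.
by move=> [c ->]; exists a => //; eexists; [exists c|].
Qed.

(** * Balls of the lp-norms *)

Lemma powR_le (R : realType) (q x y : R) :
  0 <= q -> 0 <= x -> x <= y -> x `^ q <= y `^ q.
Proof.
move=> q0 x0 xy; apply: ge0_ler_powR => //; rewrite nnegrE//.
exact: le_trans xy.
Qed.

Lemma lpballE (R : realType) (q : R) n r (v : 'rV[R]_n) : 1 <= q ->
  lpball q%:E r v <-> \sum_(i < n) `|v 0 i| `^ q <= r%:R `^ q.
Proof.
move=> q1; have q0 : 0 < q by exact: lt_le_trans q1.
rewrite /lpball /mkset /lpnorm; set s := \sum_i _.
have s0 : 0 <= s by apply: sumr_ge0 => i _; exact: powR_ge0.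
have sE : (s `^ q^-1) `^ q = s by rewrite -powRrM mulVf ?gt_eqF// powRr1.
have rE : (r%:R `^ q) `^ q^-1 = r%:R :> R.
  by rewrite -powRrM divff ?gt_eqF// powRr1.
split=> h.
  by rewrite -sE; apply: powR_le => //; [exact: ltW|exact: powR_ge0].
by rewrite -rE; apply: powR_le => //; rewrite invr_ge0 ltW.
Qed.

Lemma gauge_lpball (R : realType) (p : \bar R) n :
  (1 <= p)%E -> gauge (fun r => @lpball_int R p n r).
Proof.
have absE (z : int) : `|z%:~R| = (`|z|%N)%:R :> R by rewrite natr_absz intr_norm.
have absMn (x : int) k : `|x *+ k|%N = (k * `|x|)%N.
  by rewrite -mulr_natl natz abszM.
case: p => [q| |] q1; last by rewrite leeNy_eq in q1.
  rewrite lee_fin in q1; have q0 : 0 < q by exact: lt_le_trans q1.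
  have BE r (v : 'rV[int]_n) : lpball_int q%:E r v <->
      \sum_(i < n) (`|v 0%R i|%N)%:R `^ q <= r%:R `^ q :> R.
    rewrite /lpball_int /mkset lpballE//.
    by under eq_bigr => i _ do rewrite mxE absE.
  split.
  - move=> r u v uv /BE vr; apply/BE; apply: le_trans vr; apply: ler_sum => i _.
    by apply: powR_le; rewrite ?ler_nat// ltW.
  - move=> r s v rs /BE vr; apply/BE; apply: le_trans vr _.
    by apply: powR_le; rewrite ?ler_nat// ltW.
  - move=> k r v k0; rewrite !BE natrM powRM ?ler0n//.
    under eq_bigr => i _ do rewrite mulmxnE absMn natrM powRM ?ler0n//.
    by rewrite -mulr_sumr ler_pM2l ?powR_gt0 ?ltr0n.
  - move=> r v i /BE vr; rewrite -(ler_nat R) leNgt; apply/negP => ri.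
    move: vr; rewrite leNgt => /negP; apply.
    apply: lt_le_trans (_ : (`|v 0%R i|%N)%:R `^ q <= _); last first.
      by rewrite (bigD1 i)//= lerDl; apply: sumr_ge0 => j _; exact: powR_ge0.
    by apply: gt0_ltr_powR; rewrite ?nnegrE ?ler0n.
  - exists n.+1; apply/BE; under eq_bigr => i _ do rewrite mxE powR1.
    rewrite sumr_const card_ord -[_ *+ n]/(n%:R).
    apply: (@le_trans _ _ (n.+1%:R `^ 1)); first by rewrite powRr1// ler_nat.
    by rewrite ler_powR// ler1n.
have BE r (v : 'rV[int]_n) : @lpball_int R +oo%E n r v <-> box r v.
  rewrite /lpball_int /mkset /lpball /mkset /lpnorm /=; split => h.
    move=> i; rewrite -(ler_nat R) -absE.
    by apply: le_trans h; rewrite (le_trans _ (le_bigmax _ _ i))// mxE.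
  by apply: bigmax_le => // i _; rewrite mxE absE ler_nat.
split.
- by move=> r u v uv /BE vr; apply/BE => i; exact: leq_trans (vr i).
- by move=> r s v rs /BE vr; apply/BE => i; exact: leq_trans rs.
- move=> k r v k0; rewrite !BE; split => h i; have := h i;
    by rewrite mulmxnE absMn leq_pmul2l.
- by move=> r v i /BE.
- by exists 1%N; apply/BE => i; rewrite mxE.
Qed.

(** * Convergence of the normalized counts *)

(** Dividing by [(k * r) ^ d.+1], the terms of index [r] and [k * r] differ by at
    most [c / r]. Any two indices [r] and [s] have the common multiple [r * s], so
    the terms of index [r] and [s] differ by at most [c / r + c / s]. *)
Lemma cvgn_of_scaling (R : realType) (d c : nat) (f : nat -> nat) :
  (forall r k, (0 < r)%N -> (0 < k)%N ->
    (f (k * r)%N <= k ^ d.+1 * (f r + c * r ^ d))%N /\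
    (k ^ d.+1 * f r <= f (k * r)%N + k ^ d.+1 * (c * r ^ d))%N) ->
  cvgn (fun r => (f r)%:R / r%:R ^+ d.+1 : R).
Proof.
move=> fP; set a := fun r => _.
have ak r k : (0 < r)%N -> (0 < k)%N -> `|a (k * r)%N - a r| <= c%:R / r%:R.
  move=> r0 k0; have [] := fP r k r0 k0.
  rewrite -!(ler_nat R) !(natrM, natrD, natrX) => h1 h2.
  have rR : 0 < r%:R :> R by rewrite ltr0n.
  have kR : 0 < k%:R :> R by rewrite ltr0n.
  have kd : 0 < k%:R ^+ d.+1 :> R by rewrite exprn_gt0.
  have rd : 0 < r%:R ^+ d :> R by rewrite exprn_gt0.
  have -> : a (k * r)%N - a r =
      ((f (k * r)%N)%:R - k%:R ^+ d.+1 * (f r)%:R) / (k%:R ^+ d.+1 * r%:R ^+ d.+1).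
    by rewrite /a natrM exprMn; field; rewrite !expf_neq0 ?gt_eqF.
  rewrite normrM normfV (gtr0_norm (mulr_gt0 kd _)); last by rewrite exprn_gt0.
  rewrite ler_pdivrMr; last by rewrite mulr_gt0// exprn_gt0.
  have -> : c%:R / r%:R * (k%:R ^+ d.+1 * r%:R ^+ d.+1) =
      k%:R ^+ d.+1 * (c%:R * r%:R ^+ d) :> R.
    by rewrite [r%:R ^+ d.+1]exprS; field; rewrite gt_eqF.
  by rewrite ler_norml; apply/andP; split; lra.
apply/cauchy_cvgP/cauchy_exP => e e0.
pose r0 := (Num.bound (2 * c%:R / e)).+1.
exists (a r0); exists r0 => // r /= r0r.
rewrite /ball /=.
have r0R : 0 < r0%:R :> R by rewrite ltr0n.
have r1 : (0 < r)%N by exact: leq_trans r0r.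
have cr0 : c%:R / r0%:R < e / 2.
  have : 2 * c%:R / e < r0%:R.
    apply: lt_le_trans (archi_boundP _) _; last by rewrite ler_nat.
    by apply: divr_ge0; [exact: mulr_ge0|exact: ltW].
  by rewrite !ltr_pdivrMr// => ?; lra.
have cr : c%:R / r%:R <= c%:R / r0%:R :> R.
  by rewrite ler_wpM2l// lef_pV2 ?posrE ?ltr0n// ler_nat.
have h1 := ak r0 r isT r1; have h2 := ak r r0 r1 isT; rewrite mulnC in h2.
have := ler_distD (a (r * r0)%N) (a r0) (a r); rewrite (distrC (a r0) (a (r * r0)%N)).
by lra.
Qed.

(** If the ball of radius [r0] contains the all-ones vector, the ball of radius [r]
    contains the cube of all vectors with coordinates between 0 and [r %/ r0]. *)
Lemma gauge_growth n (B : nat -> set 'rV[int]_n) : gauge B ->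
  exists K r0, [/\ (0 < K)%N, (0 < r0)%N &
    forall r, (r0 <= r)%N -> (r ^ n <= K * cnt (B r))%N].
Proof.
move=> gB; have [r1 Br1] := gauge_absorb gB; pose r0 := r1.+1.
have Br0 : B r0 (const_mx 1) by apply: (gauge_incr gB) Br1.
exists (r0 ^ n)%N, r0; split=> [||r r0r]; rewrite ?expn_gt0//; pose q := (r %/ r0)%N.
have q0 : (0 < q)%N by rewrite divn_gt0.
have cB : (q.+1 ^ n <= cnt (B r))%N.
  pose f (u : {ffun 'I_n -> 'I_q.+1}) : 'rV[int]_n := \row_i (u i)%:Z.
  have -> : (q.+1 ^ n)%N = cnt [set: {ffun 'I_n -> 'I_q.+1}].
    by rewrite cntT card_ffun !card_ord.
  apply: (@cnt_inj _ _ _ _ f); first exact: finite_gauge.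
    move=> u _; apply: (gauge_incr gB) (leq_trunc_div r r0) _.
    apply: (gauge_solid gB) ((gauge_scale gB r0 (const_mx 1) q0).2 Br0) => i.
    by rewrite mulmxnE !mxE natz !absz_nat -ltnS ltn_ord.
  move=> u v _ _ /rowP uv; apply/ffunP => i; apply/val_inj.
  by have := uv i; rewrite !mxE => -[].
apply: leq_trans (_ : (r0 ^ n * q.+1 ^ n <= _)%N); last by rewrite leq_mul.
rewrite -expnMn; case: (n) => [|m] //; rewrite leq_exp2r//.
by rewrite mulnC ltnW// ltn_ceil.
Qed.

Definition translate n (a : 'rV[int]_n) (M : set 'rV[int]_n) : set 'rV[int]_n :=
  [set a + x | x in M].

(** Translation by [a] is injective and, off a shell whose width bounds the
    coordinates of [a], it does not change membership in the ball. *)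
Lemma gauge_translate n (B : nat -> set 'rV[int]_n) (a : 'rV[int]_n) :
  (0 < n)%N -> gauge B ->
  exists c, forall (M : set 'rV[int]_n) r, (0 < r)%N ->
    (cnt (translate a M `&` B r) <= cnt (M `&` B r) + c * r ^ n.-1)%N /\
    (cnt (M `&` B r) <= cnt (translate a M `&` B r) + c * r ^ n.-1)%N.
Proof.
move=> n0 gB; pose m := (\sum_i `|a 0%R i|)%N.
have am i : (`|a 0%R i| <= m)%N by rewrite /m (bigD1 i)//= leq_addr.
have [c cP] := thin_shell m n0 gB; exists c => M r r0.
have [fS cS] := cP r r0.
have BE u : ~ shell B m r u -> (B r (a + u) <-> B r u).
  move=> nu; have := @gauge_near _ B m 1 r u (a + u) gB isT _ nu.
  by rewrite !mul1n; apply=> i; rewrite mxE mulr1n addrK.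
have fM (N : set 'rV[int]_n) : finite_set (N `&` B r).
  exact: sub_finite_set (@subIsetr _ _ _) (finite_gauge r gB).
split.
  apply: (@leq_trans (cnt ((M `&` B r) `|` shell B m r))); last first.
    by apply: leq_trans (cntU_le (fM M) fS) _; rewrite leq_add2l.
  apply: (@cnt_inj _ _ _ _ (fun x => x - a)).
  - by rewrite finite_setU.
  - move=> _ [[x Mx <-] Bx]; rewrite [a + x]addrC addrK.
    have [|/BE xE] := pselect (shell B m r x); first by right.
    by left; split=> //; apply/xE.
  - by move=> x y _ _ /addIr.
apply: (@leq_trans (cnt ((translate a M `&` B r) `|` translate a (shell B m r)))).
  apply: (@cnt_inj _ _ _ _ (fun x => a + x)).
  - by rewrite finite_setU; split=> //; exact: finite_image.
  - move=> x [Mx Bx]; have [|/BE xE] := pselect (shell B m r x).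
      by right; exists x.
    by left; split; [exists x|apply/xE].
  - by move=> x y _ _ /addrI.
apply: leq_trans (cntU_le (fM _) _) _; first exact: finite_image.
rewrite leq_add2l (leq_trans _ cS)//.
apply: (@cnt_inj _ _ _ _ (fun x => x - a)) => //.
  by move=> _ [x xS <-]; rewrite [a + x]addrC addrK.
by move=> x y _ _ /addIr.
Qed.

Lemma rho_rE (R : realType) (p : \bar R) n (M : set 'rV[int]_n) r :
  rho_r p M r = (cnt (M `&` @lpball_int R p n r))%:R / (cnt (@lpball_int R p n r))%:R.
Proof. by []. Qed.

(** [presburger_scaling] applies to [M] and to the set of all integer points, so
    both counts divided by [r ^ n] converge; the second limit is positive by
    [gauge_growth]. *)
Lemma presburger_density (R : realType) (p : \bar R) n (M : set 'rV[int]_n) :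
  (0 < n)%N -> (1 <= p)%E -> presburger M -> has_density p M.
Proof.
move=> n0 p1 pM; have gB := gauge_lpball n p1.
set B := (fun r => _) in gB.
have cvgM (N : set 'rV[int]_n) : presburger N ->
    cvgn (fun r => (cnt (N `&` B r))%:R / r%:R ^+ n : R).
  case: n n0 B gB N {M pM} => // n _ B gB N pN.
  have [c cP] := presburger_scaling (ltn0Sn n) gB pN.
  exact: (@cvgn_of_scaling R n c (fun r => cnt (N `&` B r))).
have cM := cvgM _ pM; have cT := cvgM _ (@presburgerT n).
have [K [r0 [K0 r00 Kr]]] := gauge_growth gB.
have limT : limn (fun r => (cnt (setT `&` B r))%:R / r%:R ^+ n : R) != 0.
  rewrite gt_eqF//.
  apply: (@lt_le_trans _ _ (K%:R^-1)); first by rewrite invr_gt0 ltr0n.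
  apply: limr_ge => //; exists r0 => // r /= r0r.
  have rn : 0 < r%:R ^+ n :> R by rewrite exprn_gt0// ltr0n (leq_trans r00).
  rewrite setTI ler_pdivlMr// ler_pdivrMl ?ltr0n//.
  by rewrite -natrX -natrM ler_nat Kr.
pose f r : R := (cnt (M `&` B r))%:R / r%:R ^+ n /
  ((cnt (setT `&` B r))%:R / r%:R ^+ n).
have /cvg_ex[l fl] : cvgn f by exact: is_cvgM cM (is_cvgV limT cT).
apply/cvg_ex; exists l; apply: cvg_trans fl; apply: near_eq_cvg.
exists 1%N => // r /= r1; rewrite rho_rE /f setTI.
have rn : r%:R ^+ n != 0 :> R by rewrite expf_neq0// pnatr_eq0 -lt0n.
by rewrite invf_div mulrA divfK.
Qed.

(** The counts of [M] and of its translate in the ball of radius [r] differ by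
    [O(r ^ n.-1)], and the ball has at least [r ^ n / K] points. *)
Lemma translate_density (R : realType) (p : \bar R) n (a : 'rV[int]_n)
    (M : set 'rV[int]_n) (l : R) : (0 < n)%N -> (1 <= p)%E ->
  rho_r p M @ \oo --> l -> rho_r p (translate a M) @ \oo --> l.
Proof.
move=> n0 p1; apply: cvg_sub0; have gB := gauge_lpball n p1.
have [c cP] := gauge_translate a n0 gB.
have [K [r0 [K0 r00 Kr]]] := gauge_growth gB.
apply/cvgr0Pnorm_le => e e0.
exists (maxn r0 (Num.bound (K%:R * c%:R / e))) => // r /=.
rewrite geq_max => /andP[r0r er].
have r1 : (0 < r)%N by exact: leq_trans r0r.
have rR : 0 < r%:R :> R by rewrite ltr0n.
have Ke : K%:R * c%:R <= e * r%:R.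
  rewrite [leRHS]mulrC -ler_pdivrMr//; apply: le_trans (ltW (archi_boundP _)) _.
    by apply: divr_ge0; [exact: mulr_ge0|exact: ltW].
  by rewrite ler_nat.
have B0 : (0 < cnt (@lpball_int R p n r))%N.
  have := Kr r r0r; case: (cnt _) => //.
  by rewrite muln0 leqn0 expn_eq0 gtn_eqF.
have BR : 0 < (cnt (@lpball_int R p n r))%:R :> R by rewrite ltr0n.
have [] := cP M r r1; rewrite -!(ler_nat R) !natrD => h1 h2.
have h3 : (c * r ^ n.-1)%N%:R <= e * (cnt (@lpball_int R p n r))%:R.
  have KR : 0 < K%:R :> R by rewrite ltr0n.
  have := Kr r r0r; rewrite -(ler_nat R) !(natrM, natrX) => rn.
  rewrite -(ler_pM2l KR); apply: le_trans (_ : e * r%:R ^+ n <= _).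
    by case: (n) n0 => // m _; rewrite exprS !mulrA ler_wpM2r.
  by rewrite mulrCA ler_wpM2l// ltW.
rewrite -[(_ - _) r]/(rho_r p (translate a M) r - rho_r p M r) !rho_rE.
rewrite -mulrBl normrM normfV (gtr0_norm BR) ler_pdivrMr//.
by rewrite ler_norml; apply/andP; split; lra.
Qed.

(** * The density of rational sets *)

Lemma cntU (T : choiceType) (A B : set T) :
  finite_set A -> finite_set B -> A `&` B = set0 ->
  cnt (A `|` B) = (cnt A + cnt B)%N.
Proof.
move=> fA fB AB0; rewrite /cnt -cardfsUI -fset_setI// AB0 fset_set0 cardfs0.
by rewrite addn0 fset_setU.
Qed.

Lemma cnt_bigcup (T : choiceType) (I : finType) (E : I -> set T) :
  (forall i, finite_set (E i)) ->
  (forall i j, i != j -> E i `&` E j = set0) ->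
  cnt (\bigcup_i E i) = (\sum_i cnt (E i))%N.
Proof.
move=> fE dE; have fs (s : seq I) : finite_set [set x | exists2 i, i \in s & E i x].
  have -> : [set x | exists2 i, i \in s & E i x] = \bigcup_(i in [set` s]) E i.
    by apply/seteqP; split => x [i is_ Ex]; exists i.
  exact: bigcup_finite.
have cs (s : seq I) : uniq s ->
    cnt [set x | exists2 i, i \in s & E i x] = (\sum_(i <- s) cnt (E i))%N.
  elim: s => [_|i s IHs /=/andP[nis us]].
    rewrite big_nil (_ : mkset _ = set0); first by rewrite /cnt fset_set0.
    by apply/seteqP; split => x // [].
  rewrite big_cons -IHs// -cntU//.
    congr cnt; apply/seteqP; split => x.
      by move=> [j]; rewrite inE => /orP[/eqP->|js] Ex; [left|right; exists j].
    by move=> [Ex|[j js Ex]]; [exists i|exists j]; rewrite // inE ?eqxx// js orbT.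
  apply/seteqP; split => x // [Eix [j js Ejx]].
  have ij : i != j by apply: contraNneq nis => ->.
  by rewrite -(dE _ _ ij).
rewrite -cs ?index_enum_uniq//; congr cnt; apply/seteqP; split => x [i _ Ex];
  by exists i; rewrite ?mem_index_enum.
Qed.

Lemma rho_r_bigcup (R : realType) (p : \bar R) n k (L : 'I_k -> set 'rV[int]_n) :
  (1 <= p)%E -> (forall i j, i != j -> L i `&` L j = set0) ->
  rho_r p (\bigcup_i L i) = \sum_i rho_r p (L i).
Proof.
move=> p1 dL; apply/funext => r; rewrite fct_sumE.
have fL i : finite_set (L i `&` @lpball_int R p n r).
  exact: sub_finite_set (@subIsetr _ _ _) (finite_lpball_int n r p1).
under eq_bigr do rewrite rho_rE.
rewrite -mulr_suml rho_rE -natr_sum -cnt_bigcup ?setI_bigcupl//.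
by move=> i j ij; rewrite setIACA dL ?set0I.
Qed.

Theorem theorem2p2 (R : realType) (n : nat) (n_gt0 : (0 < n)%N)
    (p : \bar R) (p_ge1 : (1 <= p)%E)
    (X : set 'rV[int]_n) (ratX : rational_subset X) :
  has_density p X /\
  (forall (k : nat) (a : 'I_k -> 'rV[int]_n) (B : 'I_k -> {fset 'rV[int]_n}),
     semi_simple_decomposition X a B ->
     (forall i : 'I_k, has_density p (star [set` B i])) /\
     rho p X = \sum_(i < k) rho p (star [set` B i])).
Proof.
split.
  exact/presburger_density/semilinear_presburger/rational_semilinear.
move=> k a B [_ disj XE].
have dB i : has_density p (star [set` B i]).
  apply: presburger_density => //; apply: semilinear_presburger.
  rewrite (_ : star _ = shifted (0, enum_fset (B i))).
    exact: semilinear_shifted.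
  apply/seteqP; split => [x Bx|_ [_ -> [x Bx <-]]].
    by exists 0 => //; exists x => //; rewrite add0r.
  by rewrite add0r.
split=> //; apply: cvg_lim => //.
rewrite XE rho_r_bigcup//.
rewrite (_ : \sum_i rho_r _ _ =
  fun r => \sum_i rho_r p (linear_set (a i) (B i)) r); last first.
  by apply/funext => r; rewrite fct_sumE.
apply: cvg_big => //; first exact: add_continuous.
by move=> i _; exact: translate_density (dB i).
Qed.
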